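(* Let $G$ be an amenable (discrete) group such that the integral group ring $\mathbb{Z}[G]$ is a domain. If $G$ has cohomological dimension $n$ (over $\mathbb{Z}$) and is of type $FP_{n-1}$, then $G$ is of type $FP$.
   Context: All groups are discrete. Cohomological dimension $\mathrm{cd}(G)$ is over $\mathbb{Z}$: the length of the shortest projective $\mathbb{Z}[G]$-resolution of the trivial module $\mathbb{Z}$ (infinite if no finite length projective resolution exists). $G$ is of type $FP_n$ if there is a projective $\mathbb{Z}[G]$-resolution $P_*$ of the trivial module $\mathbb{Z}$ with $P_d$ finitely generated for all $0\le d\le n$. $G$ is of type $FP$ if there is a finite length projective $\mathbb{Z}[G]$-resolution $P_*$ of $\mathbb{Z}$ with every $P_d$ finitely generated. A group $G$ is amenable if for every continuous action of $G$ on a compact Hausdorff space $X$ there is a $G$-invariant probability measure on $X$. A domain is a ring without non-trivial zero divisors (not necessarily commutative). *)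

(* Defs.v *)
From HB Require Import structures.
From mathcomp Require Import all_boot all_order all_algebra.
From mathcomp Require Import finmap.
From mathcomp Require Import all_classical all_reals all_analysis.
(* The notations of monalg clash with those of MathComp-Analysis. *)
From mathcomp Require Import -(notations) monalg.

Set Implicit Arguments.
Unset Strict Implicit.
Unset Printing Implicit Defensive.

Import Order.TTheory GRing.Theory Num.Theory.
Local Open Scope classical_set_scope.
Local Open Scope ring_scope.

(* [malg G int] is the free abelian group on [G]; its library product is
   only available when [x * y = 1] forces [x = y = 1], hence this alias,
   which carries the convolution product for an arbitrary group. *)
Definition group_ring (G : groupType) : Type := malg G int.

Section GroupRing.
Variable G : groupType.
Implicit Types (x y z : group_ring G).

HB.instance Definition _ := GRing.Zmodule.on (group_ring G).

Definition gr_one : group_ring G := mkmalgU 1%g 1.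

Definition gr_mul x y : group_ring G :=
  \sum_(g <- msupp x) \sum_(h <- msupp y)
    mkmalgU (g * h)%g (mcoeff g x * mcoeff h y).

Lemma gr_mulw (d1 d2 : {fset G}) x y :
  fsubset (msupp x) d1 -> fsubset (msupp y) d2 ->
  gr_mul x y = \sum_(g <- d1) \sum_(h <- d2) mkmalgU (g * h)%g (mcoeff g x * mcoeff h y).
Proof.
move=> le1 le2; rewrite /gr_mul (big_fset_incl _ le1) /=.
  apply: eq_bigr => g _; apply/big_fset_incl => // h _ /mcoeff_outdom ->.
  by rewrite mulr0 monalgU0.
move=> g _ /mcoeff_outdom xg.
by rewrite big1 => // h _; rewrite xg mul0r monalgU0.
Qed.

Lemma gr_mulDl : left_distributive gr_mul +%R.
Proof.
move=> x y z.
have lexy := msuppD_le x y.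
rewrite (gr_mulw lexy (fsubset_refl _)).
rewrite (gr_mulw (fsubsetUl _ (msupp y)) (fsubset_refl (msupp z))).
rewrite (gr_mulw (fsubsetUr (msupp x) _) (fsubset_refl (msupp z))).
rewrite -big_split /=; apply: eq_bigr => g _.
rewrite -big_split /=; apply: eq_bigr => h _.
by rewrite mcoeffD mulrDl monalgUD.
Qed.

Lemma gr_mulDr : right_distributive gr_mul +%R.
Proof.
move=> z x y.
have lexy := msuppD_le x y.
rewrite (gr_mulw (fsubset_refl _) lexy).
rewrite (gr_mulw (fsubset_refl (msupp z)) (fsubsetUl _ (msupp y))).
rewrite (gr_mulw (fsubset_refl (msupp z)) (fsubsetUr (msupp x) _)).
rewrite -big_split /=; apply: eq_bigr => g _.
rewrite -big_split /=; apply: eq_bigr => h _.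
by rewrite mcoeffD mulrDr monalgUD.
Qed.

Lemma gr_mul0l x : gr_mul 0 x = 0.
Proof. by rewrite /gr_mul msupp0 big_seq_fset0. Qed.

Lemma gr_mul0r x : gr_mul x 0 = 0.
Proof.
by rewrite /gr_mul big1 // => g _; rewrite msupp0 big_seq_fset0.
Qed.

Lemma gr_mul_suml (I : Type) (r : seq I) (F : I -> group_ring G) x :
  gr_mul (\sum_(i <- r) F i) x = \sum_(i <- r) gr_mul (F i) x.
Proof.
exact: (big_morph (gr_mul^~ x) (fun _ _ => gr_mulDl _ _ _) (gr_mul0l x)).
Qed.

Lemma gr_mul_sumr (I : Type) (r : seq I) (F : I -> group_ring G) x :
  gr_mul x (\sum_(i <- r) F i) = \sum_(i <- r) gr_mul x (F i).
Proof.
exact: (big_morph (gr_mul x) (fun _ _ => gr_mulDr _ _ _) (gr_mul0r x)).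
Qed.

Lemma gr_mulUU (a b : int) (g h : G) :
  gr_mul (mkmalgU g a) (mkmalgU h b) = mkmalgU (g * h)%g (a * b).
Proof. by rewrite (gr_mulw msuppU_le msuppU_le) !big_seq_fset1 !mcoeffUU. Qed.

Lemma gr_expand x : x = \sum_(g <- msupp x) (mkmalgU g (mcoeff g x) : group_ring G).
Proof. exact: monalgE. Qed.

Lemma gr_mul1l : left_id gr_one gr_mul.
Proof.
move=> x; rewrite [in LHS](gr_expand x) gr_mul_sumr [RHS]gr_expand.
by apply: eq_bigr => g _; rewrite gr_mulUU mul1r mul1g.
Qed.

Lemma gr_mul1r : right_id gr_one gr_mul.
Proof.
move=> x; rewrite [in LHS](gr_expand x) gr_mul_suml [RHS]gr_expand.
by apply: eq_bigr => g _; rewrite gr_mulUU mulr1 mulg1.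
Qed.

Lemma gr_mulA : associative gr_mul.
Proof.
move=> x y z; rewrite (gr_expand x) !gr_mul_suml.
apply: eq_bigr => g _; rewrite (gr_expand y) gr_mul_suml !gr_mul_sumr gr_mul_suml.
apply: eq_bigr => h _; rewrite (gr_expand z) !gr_mul_sumr.
by apply: eq_bigr => k _; rewrite !gr_mulUU mulrA mulgA.
Qed.

Lemma gr_one_neq0 : gr_one != 0.
Proof. by rewrite monalgU_eq0. Qed.

HB.instance Definition _ := GRing.Zmodule_isNzRing.Build (group_ring G)
  gr_mulA gr_mul1l gr_mul1r gr_mulDl gr_mulDr gr_one_neq0.

Definition gr_aug x : int := \sum_(g <- msupp x) mcoeff g x.

Lemma gr_augw (d : {fset G}) x :
  fsubset (msupp x) d -> gr_aug x = \sum_(g <- d) mcoeff g x.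
Proof. by move=> le; apply/big_fset_incl => // g _ /mcoeff_outdom. Qed.

Lemma gr_augD : {morph gr_aug : x y / x + y}.
Proof.
move=> x y; rewrite (gr_augw (msuppD_le x y)).
rewrite (gr_augw (fsubsetUl _ (msupp y))) (gr_augw (fsubsetUr (msupp x) _)).
by rewrite -big_split; apply: eq_bigr => g _; rewrite mcoeffD.
Qed.

Lemma gr_augU (a : int) (g : G) : gr_aug (mkmalgU g a) = a.
Proof. by rewrite (gr_augw msuppU_le) big_seq_fset1 mcoeffUU. Qed.

Lemma gr_aug_sum (I : Type) (r : seq I) (F : I -> group_ring G) :
  gr_aug (\sum_(i <- r) F i) = \sum_(i <- r) gr_aug (F i).
Proof.
apply: (big_morph gr_aug gr_augD).
by rewrite /gr_aug msupp0 big_seq_fset0.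
Qed.

Lemma gr_aug1 : gr_aug 1 = 1.
Proof. exact: gr_augU. Qed.

Lemma gr_augM : {morph gr_aug : x y / x * y}.
Proof.
move=> x y; rewrite gr_aug_sum mulr_suml; apply: eq_bigr => g _.
rewrite gr_aug_sum mulr_sumr; apply: eq_bigr => h _.
exact: gr_augU.
Qed.

End GroupRing.

(* [int] on which every element of [G] acts as the identity. *)
Definition trivial_module (G : groupType) : Type := int.

Section TrivialModule.
Variable G : groupType.
Implicit Types (x y : group_ring G) (m n : trivial_module G).

HB.instance Definition _ := GRing.Zmodule.on (trivial_module G).

Definition trivial_scale x m : trivial_module G := gr_aug x * (m : int).

Lemma trivial_scaleA x y m :
  trivial_scale x (trivial_scale y m) = trivial_scale (x * y) m.
Proof. by rewrite /trivial_scale gr_augM mulrA. Qed.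

Lemma trivial_scale1 : left_id 1 trivial_scale.
Proof. by move=> m; rewrite /trivial_scale gr_aug1 mul1r. Qed.

Lemma trivial_scaleDr : right_distributive trivial_scale +%R.
Proof. by move=> x m n; rewrite /trivial_scale mulrDr. Qed.

Lemma trivial_scaleDl m : {morph trivial_scale^~ m : x y / x + y}.
Proof. by move=> x y; rewrite /trivial_scale gr_augD mulrDl. Qed.

HB.instance Definition _ := GRing.Zmodule_isLmodule.Build (group_ring G)
  (trivial_module G)
  trivial_scaleA trivial_scale1 trivial_scaleDr trivial_scaleDl.

End TrivialModule.

Section Modules.
Variable A : nzRingType.

Definition finitely_generated (M : lmodType A) : Prop :=
  exists s : seq M, forall x : M,
    exists c : 'I_(size s) -> A, x = \sum_(i < size s) c i *: s`_i.

Definition projective (P : lmodType A) : Prop :=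
  forall (M N : lmodType A) (f : {linear M -> N}) (g : {linear P -> N}),
    (forall y : N, exists x : M, f x = y) ->
    exists h : {linear P -> M}, forall x : P, f (h x) = g x.

Record proj_resolution (M : lmodType A) := ProjResolution {
  res_obj :> nat -> lmodType A;
  res_diff : forall k, {linear res_obj k.+1 -> res_obj k};
  res_aug : {linear res_obj 0 -> M};
  res_projective : forall k, projective (res_obj k);
  res_aug_surj : forall m : M, exists x, res_aug x = m;
  res_exact0 : forall x, res_aug x = 0 <-> exists y, res_diff 0 y = x;
  res_exactS : forall k x,
    res_diff k x = 0 <-> exists y, res_diff k.+1 y = x
}.

Definition length_le (M : lmodType A) (P : proj_resolution M) (n : nat) :=
  forall k, (n < k)%N -> forall x : P k, x = 0.

End Modules.

Section FinitenessProperties.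
Variable G : groupType.

Definition cd_le (n : nat) : Prop :=
  exists P : proj_resolution (trivial_module G), length_le P n.

Definition has_cd (n : nat) : Prop :=
  cd_le n /\ forall m, cd_le m -> (n <= m)%N.

(* The index is an integer so that the condition is vacuous for [n = -1]. *)
Definition type_FPn (n : int) : Prop :=
  exists P : proj_resolution (trivial_module G),
    forall d : nat, d%:Z <= n -> finitely_generated (P d).

Definition type_FP : Prop :=
  exists P : proj_resolution (trivial_module G),
    (exists n, length_le P n) /\ forall d, finitely_generated (P d).

End FinitenessProperties.

Definition Borel (X : ptopologicalType) := g_sigma_algebraType (@open X).

(* [X] is pointed, i.e. nonempty, as the empty space carries no probability
   measure. *)
Definition amenable (R : realType) (G : groupType) : Prop :=
  forall (X : ptopologicalType) (act : G -> X -> X),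
    compact [set: X] -> hausdorff_space X ->
    (forall x, act 1%g x = x) ->
    (forall g h x, act (g * h)%g x = act g (act h x)) ->
    continuous (fun p : discrete_topology G * X => act p.1 p.2) ->
    exists P : probability (Borel X) R,
      forall (g : G) (B : set (Borel X)), measurable B ->
        P (act g @^-1` B) = P B.

(* Main.v *)
Require Import Defs.
From HB Require Import structures.
From mathcomp Require Import all_boot all_order all_fingroup all_algebra.
From mathcomp Require Import finmap all_classical all_reals all_analysis.
From mathcomp Require Import -(notations) monalg.

(** The group ring of an amenable group without zero divisors is a left Ore
    domain, and over a left Ore domain a projective module of finite rank is
    finitely generated.

    Let P be a projective resolution of the trivial module with P_0, ..., P_m
    finitely generated, where n = m + 1.  Comparing P with a resolution of
    length n shows that the image K of P_(m+1) in P_m is projective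
    ([resolution_split]), so that P can be cut off after K
    ([resolution_truncation]).  Now K embeds in P_m, which embeds in a free
    module of finite rank.  Over a left Ore domain K therefore contains
    finitely many elements y_1, ..., y_r such that every x in K has a nonzero
    multiple in their span ([finite_rank]).  Embed K as a direct summand of a
    free module on a possibly infinite basis.  The finitely many basis vectors
    that occur in the y_i also contain the support of every nonzero multiple of
    x that lies in their span; as there are no zero divisors they contain the
    support of x itself.  So K is a quotient of a free module of finite rank
    ([projective_finite_rank]).

    For the Ore condition, suppose that a and b are nonzero elements of Z[G]
    without a common nonzero left multiple.  Then the translates g a and g b,
    for g in G, are linearly independent over Z.  A nonzero minor of the matrix
    of finitely many of them has a nonzero term in its Leibniz expansion
    ([independent_transversal]), that is, an injective choice of a point in the
    support of each translate.  By compactness there is such a choice for all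
    translates at once, an injective map F from G x {a, b} to G that moves
    points by a bounded amount.  The space of all such F is compact and G acts
    on it by translation.  An invariant probability measure on this space
    cannot exist ([amenable_no_doublings]): F(1, a) = s and F(s^-1, a) = 1 have
    the same probability by invariance, and summing over s shows that the
    identity almost surely is a value of F on G x {a}.  The same holds for
    G x {b}, although F is injective. *)

Set Implicit Arguments.
Unset Strict Implicit.
Unset Printing Implicit Defensive.

Import Order.TTheory GRing.Theory Num.Theory.
Local Open Scope ring_scope.

(** * Images of linear maps and projective modules *)

Section RangeModule.
Variables (A : nzRingType) (M N : lmodType A) (f : {linear M -> N}).

Definition range_pred : {pred N} := fun y => `[< exists x, f x = y >].

Lemma range_submod_closed : submod_closed range_pred.
Proof.
split; first by apply/asboolP; exists 0; rewrite linear0.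
move=> a y z /asboolP[u <-] /asboolP[v <-].
by apply/asboolP; exists (a *: u + v); rewrite linearP.
Qed.

HB.instance Definition _ :=
  GRing.isSubmodClosed.Build A N range_pred range_submod_closed.

Definition range_module := {y : N | range_pred y}.

HB.instance Definition _ := SubChoice.on range_module.
HB.instance Definition _ := [SubChoice_isSubLmodule of range_module by <:].

Lemma range_moduleP (y : range_module) : exists x, f x = \val y.
Proof. exact: asboolW (valP y). Qed.

Definition to_range (x : M) : range_module :=
  exist _ (f x) (asboolT (ex_intro _ x erefl)).

Lemma to_range_linear : linear to_range.
Proof. by move=> a x y; apply: val_inj; rewrite /= linearP. Qed.

HB.instance Definition _ :=
  GRing.isLinear.Build A M range_module *:%R to_range to_range_linear.

End RangeModule.

Section Modules.
Variable A : nzRingType.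

Lemma linear_corestrict (L M N : lmodType A) (f : {linear M -> N})
    (g : {linear L -> N}) :
  (forall x, exists y, f y = g x) ->
  exists h : {linear L -> range_module f}, forall x, \val (h x) = g x.
Proof.
move=> fg.
pose h x : range_module f := exist _ (g x) (asboolT (fg x)).
have h_linear : linear h by move=> a x y; apply: val_inj; rewrite /= linearP.
pose hL := GRing.isLinear.Build A L (range_module f) *:%R h h_linear.
by exists (HB.pack h hL : {linear L -> range_module f}).
Qed.

(** The map being lifted along need not be surjective: it becomes so after
    restricting its codomain to its range. *)
Lemma projective_lift (P M N : lmodType A) (f : {linear M -> N})
    (g : {linear P -> N}) :
  projective P -> (forall x, exists y, f y = g x) ->
  exists h : {linear P -> M}, forall x, f (h x) = g x.
Proof.
move=> projP fg; have [g' g'E] := linear_corestrict fg.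
have [|h hE] := projP _ _ (to_range f : {linear M -> range_module f}) g'.
  move=> y; have [x fx] := range_moduleP y; exists x; exact: val_inj.
by exists h => x; rewrite -g'E -hE.
Qed.

Lemma projective_retract (P T : lmodType A) (s : {linear T -> P})
    (r : {linear P -> T}) :
  cancel s r -> projective P -> projective T.
Proof.
move=> sK projP M N f g f_surj.
have [h hE] := projP _ _ f (g \o r : {linear P -> N}) f_surj.
by exists (h \o s : {linear T -> M}) => x; rewrite /= hE /= sK.
Qed.

Lemma finitely_generated_quotient (P T : lmodType A) (r : {linear P -> T}) :
  (forall y, exists x, r x = y) -> finitely_generated P ->
  finitely_generated T.
Proof.
move=> r_surj [s sP]; exists (map r s) => y; rewrite size_map.
have [x <-] := r_surj y; have [c ->] := sP x; exists c.
rewrite linear_sum; apply: eq_bigr => i _.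
by rewrite linearZ /= (nth_map 0).
Qed.

End Modules.

(** * Comparing and truncating resolutions *)

Section Comparison.
Variables (A : nzRingType) (M : lmodType A) (P Q : proj_resolution M).

(** The chain maps f, g between P and Q and the homotopy h from g f to the
    identity, built degree by degree.  The usual homotopy relation in degree k
    involves h in degree k - 1 composed with the differential, which vanishes
    on boundaries; stating it on boundaries only makes degree 0 and the
    induction step uniform, and keeps each degree independent of the maps
    chosen in lower degrees. *)
Lemma resolution_comparison (k : nat) :
  exists (f : {linear P k -> Q k}) (g : {linear Q k -> P k})
         (h : {linear P k -> P k.+1}),
  [/\ forall x, exists y, res_diff Q k y = f (res_diff P k x),
      forall x, exists y, res_diff P k y = g (res_diff Q k x) &
      forall x, g (f (res_diff P k x)) + res_diff P k (h (res_diff P k x)) =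
                res_diff P k x].
Proof.
elim: k => [|k [f [g [h [fP gP hP]]]]].
  have [f fE] := projective_lift (g := res_aug P) (@res_projective _ _ P 0)
    (fun x => @res_aug_surj _ _ Q (res_aug P x)).
  have [g gE] := projective_lift (g := res_aug Q) (@res_projective _ _ Q 0)
    (fun x => @res_aug_surj _ _ P (res_aug Q x)).
  pose u : {linear P 0 -> P 0} := idfun \- (g \o f).
  have [x|h hE] := projective_lift (f := res_diff P 0) (g := u)
    (@res_projective _ _ P 0).
    by apply/res_exact0; rewrite /= linearB /= gE fE subrr.
  exists f, g, h; split=> x.
  - by apply/res_exact0; rewrite fE; apply/res_exact0; exists x.
  - by apply/res_exact0; rewrite gE; apply/res_exact0; exists x.
  - by rewrite hE /= addrCA subrr addr0.
have [f' f'E] := projective_lift (f := res_diff Q k)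
  (g := f \o res_diff P k) (@res_projective _ _ _ k.+1) fP.
have [g' g'E] := projective_lift (f := res_diff P k)
  (g := g \o res_diff Q k) (@res_projective _ _ _ k.+1) gP.
(* The defect of g' f' from the identity, corrected by h, takes values in
   cycles, hence lifts through the next differential. *)
pose u : {linear P k.+1 -> P k.+1} :=
  idfun \- (g' \o f') \- (h \o res_diff P k).
have [x|h' h'E] := projective_lift (f := res_diff P k.+1) (g := u)
  (@res_projective _ _ P k.+1).
  apply/res_exactS; rewrite /= !linearB /= g'E /= f'E /=.
  by rewrite -{1}[res_diff P k x]hP addrAC addrK subrr.
have dd (R : proj_resolution M) (x : R k.+2) :
  res_diff R k (res_diff R k.+1 x) = 0 by apply/res_exactS; exists x.
exists f', g', h'; split=> x.
- by apply/res_exactS; rewrite f'E /= dd linear0.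
- by apply/res_exactS; rewrite g'E /= dd linear0.
- by rewrite h'E /= dd linear0 subr0 addrCA subrr addr0.
Qed.

(** If Q stops in degree k + 1, then the boundaries of P in degree k form a
    projective module: e is the projection of P_(k+1) onto a complement of the
    cycles.  It is g f + h d, and it kills a cycle y because f y is then a cycle
    of Q in degree k + 1, hence zero. *)
Lemma resolution_split (k : nat) :
  (forall z, res_diff Q k z = 0 -> z = 0) ->
  exists e : {linear P k.+1 -> P k.+1},
    (forall y, res_diff P k (e y) = res_diff P k y) /\
    (forall y, res_diff P k y = 0 -> e y = 0).
Proof.
move=> Q_inj; have [f [g [h [fP gP hP]]]] := resolution_comparison k.
have [f' f'E] := projective_lift (f := res_diff Q k)
  (g := f \o res_diff P k) (@res_projective _ _ _ k.+1) fP.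
have [g' g'E] := projective_lift (f := res_diff P k)
  (g := g \o res_diff Q k) (@res_projective _ _ _ k.+1) gP.
exists ((g' \o f') \+ (h \o res_diff P k)); split=> y /=.
  by rewrite linearD g'E /= f'E /= hP.
move=> dy; have /Q_inj -> : res_diff Q k (f' y) = 0.
  by rewrite f'E /= dy linear0.
by rewrite dy !linear0 addr0.
Qed.

End Comparison.

Section Retract.
Variables (A : nzRingType) (M : lmodType A) (P : proj_resolution M).

(** An idempotent chain endomorphism E over the identity of M splits off a
    resolution: a cycle x = E x that bounds y in P also bounds E y. *)
Lemma resolution_retract (E : forall k, {linear P k -> P k}) :
  (forall x, res_aug P (E 0%N x) = res_aug P x) ->
  (forall k x, res_diff P k (E k.+1 x) = E k (res_diff P k x)) ->
  (forall k x, E k (E k x) = E k x) ->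
  exists T : proj_resolution M, forall k,
    exists (s : {linear T k -> P k}) (r : {linear P k -> T k}),
      cancel s r /\ forall x, s (r x) = E k x.
Proof.
move=> augE dE EE.
have valE k (x : range_module (E k)) : E k (\val x) = \val x.
  by have [y <-] := range_moduleP x; rewrite EE.
have valK k : cancel (\val : range_module (E k) -> P k) (to_range (E k)).
  by move=> x; apply: val_inj; rewrite /= valE.
have diffP k : exists d : {linear range_module (E k.+1) -> range_module (E k)},
    forall x, \val (d x) = res_diff P k (\val x).
  apply: (linear_corestrict
    (g := res_diff P k \o
      (\val : {linear range_module (E k.+1) -> P k.+1}))) => x.
  by exists (res_diff P k (\val x)); rewrite -dE /= valE.
pose d k := projT1 (cid (diffP k)).
have dP k x : \val (d k x) = res_diff P k (\val x) := projT2 (cid (diffP k)) x.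
pose aug : {linear range_module (E 0) -> M} := res_aug P \o \val.
have proj k : projective (range_module (E k)) :=
  projective_retract (@valK k) (@res_projective _ _ P k).
have aug_surj m : exists x, aug x = m.
  have [x <-] := @res_aug_surj _ _ P m.
  by exists (to_range (E 0%N) x); rewrite /aug /= augE.
have exact0 x : aug x = 0 <-> exists y, d 0%N y = x.
  split=> [/res_exact0[y dy]|[y <-]].
    exists (to_range (E 1%N) y); apply: val_inj.
    by rewrite dP /= dE dy valE.
  by apply/res_exact0; exists (\val y); rewrite -dP.
have exactS k x : d k x = 0 <-> exists y, d k.+1 y = x.
  split=> [/(congr1 \val)|[y <-]].
    rewrite dP => /res_exactS[y dy].
    exists (to_range (E k.+2) y); apply: val_inj.
    by rewrite dP /= dE dy valE.
  by apply: val_inj; rewrite !dP; apply/res_exactS; exists (\val y).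
exists (ProjResolution proj aug_surj exact0 exactS) => k /=.
by exists \val, (to_range (E k)).
Qed.

(** The truncation is the range of the chain endomorphism that is the identity
    up to degree m, e in degree m + 1 and zero above; its degrees are retracts
    of those of P, so they are projective. *)
Lemma resolution_truncation (m : nat) (e : {linear P m.+1 -> P m.+1}) :
  (forall y, res_diff P m (e y) = res_diff P m y) ->
  (forall y, res_diff P m y = 0 -> e y = 0) ->
  exists T : proj_resolution M, length_le T m.+1 /\ forall k,
    exists (s : {linear T k -> P k}) (r : {linear P k -> T k}), cancel s r.
Proof.
move=> de e0.
(* The case k = m + 1 is stated through a transport, since e lives in the
   single degree m + 1 while E ranges over all degrees. *)
have EP k : exists E : {linear P k -> P k},
    [/\ (k <= m)%N -> forall x, E x = x,
        (m.+1 < k)%N -> forall x, E x = 0 &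
        forall km : k = m.+1,
          forall x, E x = eq_rect_r (fun i => P i -> P i) e km x].
  have [km|mk|km] := ltngtP k m.+1; last 1 first.
  - subst k; exists e; split; rewrite ?ltnn // => km x.
    by rewrite (eq_irrelevance km erefl).
  - by exists idfun; split=> // km1; rewrite km1 ltnn in km.
  - exists \0; split=> [|//|km1]; first by rewrite leqNgt ltnW.
    by rewrite km1 ltnn in mk.
pose E k := projT1 (cid (EP k)).
have Eid k : (k <= m)%N -> E k =1 id.
  by move=> km x; rewrite /E; case: cid => F [/= + _ _]; apply.
have E0 k : (m.+1 < k)%N -> forall x, E k x = 0.
  by move=> km x; rewrite /E; case: cid => F [/= _ + _]; apply.
have Ee x : E m.+1 x = e x.
  by rewrite /E; case: cid => F [/= _ _ /(_ erefl)]; apply.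
have dd k (x : P k.+2) : res_diff P k (res_diff P k.+1 x) = 0.
  by apply/res_exactS; exists x.
have [x|k x|k x|T TP] := @resolution_retract E.
- by rewrite Eid.
- have [km|mk|km] := ltngtP k m.
  + by rewrite !Eid // ltnW.
  + rewrite E0 // linear0; have [km|kNm] := eqVneq k m.+1.
      by subst k; rewrite Ee e0 // dd.
    by rewrite E0 // ltn_neqAle eq_sym kNm.
  + by subst k; rewrite Ee de Eid.
- have [km|mk|km] := ltngtP k m.+1.
  + by rewrite !Eid.
  + by rewrite !E0.
  + subst k; rewrite !Ee; apply: subr0_eq; rewrite -raddfB.
    by apply: e0; rewrite raddfB /= de subrr.
exists T; split=> [k mk x|k]; last by have [s [r [sK _]]] := TP k; exists s, r.
have [s [r [sK srE]]] := TP k.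
by rewrite -[x]sK -[r _]sK srE E0 // linear0.
Qed.

End Retract.

(** * Projective modules over a left Ore domain *)

Definition left_Ore (A : nzRingType) : Prop :=
  forall a b : A, b != 0 -> exists c d, c != 0 /\ c * a = d * b.

(** The finitely supported functions [malg K A] serve as the free left
    [A]-module on the set [K]. *)
Section FreeModule.
Variables (A : nzRingType) (K : choiceType).
Implicit Types g : malg K A.

Definition coordinate (k : K) (g : malg K A) : A^o := mcoeff k g.

Lemma coordinate_linear k : linear (coordinate k).
Proof. by move=> a g h; rewrite /coordinate mcoeffD mcoeffZ. Qed.

HB.instance Definition _ k :=
  GRing.isLinear.Build A (malg K A) A^o *:%R (coordinate k)
    (coordinate_linear k).

Definition combination (M : lmodType A) (phi : K -> M) (g : malg K A) : M :=
  \sum_(k <- msupp g) mcoeff k g *: phi k.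

Lemma combinationw (M : lmodType A) (phi : K -> M) (D : {fset K}) g :
  fsubset (msupp g) D -> combination phi g = \sum_(k <- D) mcoeff k g *: phi k.
Proof.
move=> le; apply/big_fset_incl => // k _ /mcoeff_outdom ->.
by rewrite scale0r.
Qed.

Lemma combination_linear (M : lmodType A) (phi : K -> M) :
  linear (combination phi).
Proof.
move=> a g h; pose D := fsetU (msupp g) (msupp h).
rewrite (@combinationw _ _ D); last first.
  exact: fsubset_trans (msuppD_le _ _) (fsetSU _ (msuppZ_le _ _)).
rewrite (combinationw phi (fsubsetUl _ (msupp h))).
rewrite (combinationw phi (fsubsetUr (msupp g) _)).
rewrite scaler_sumr -big_split; apply: eq_bigr => k _.
by rewrite mcoeffD mcoeffZ scalerDl scalerA.
Qed.

HB.instance Definition _ (M : lmodType A) (phi : K -> M) :=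
  GRing.isLinear.Build A (malg K A) M *:%R (combination phi)
    (combination_linear phi).

(** Coordinates on a projective module for a generating family: a section of
    the surjection from the free module on that family. *)
Lemma dual_basis (P : lmodType A) (phi : K -> P) :
  projective P -> (forall x, exists g, combination phi g = x) ->
  exists sigma : {linear P -> malg K A}, cancel sigma (combination phi).
Proof. by move=> projP /(projP _ _ (combination phi) idfun). Qed.

End FreeModule.

Section FiniteRank.
Variable A : nzRingType.
Hypothesis domainA : GRing.integral_domain_axiom A.
Hypothesis oreA : left_Ore A.

(** The common kernel of finitely many linear forms has finite corank, in the
    sense of linear dependence up to a nonzero multiplier.  Adding a form t
    costs at most one vector p, chosen in the kernel of the earlier forms with
    t p nonzero; the Ore condition then cancels t on a nonzero multiple of any
    vector of that kernel by subtracting a multiple of p. *)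
Lemma finite_rank (V : lmodType A) (n : nat) (l : 'I_n -> {linear V -> A^o}) :
  exists s : seq V, forall x, exists (a : A) (c : nat -> A), a != 0 /\
    forall i, l i (a *: x - \sum_(j < size s) c j *: s`_j) = 0.
Proof.
elim: n l => [|n IHn] l.
  by exists [::] => x; exists 1, (fun=> 0); split=> [|[]//]; exact: oner_neq0.
have [s sP] := IHn (fun i => l (lift ord_max i)).
pose t := l ord_max.
have [tker|] := pselect (forall y,
    (forall i : 'I_n, l (lift ord_max i) y = 0) -> t y = 0).
  exists s => x; have [a [c [a0 lac]]] := sP x; exists a, c; split=> // i.
  by case: (unliftP ord_max i) => [j|] ->; [exact: lac | exact: tker].
move=> /existsNP[p /not_implyP[lp /eqP tp]].
exists (p :: s) => x; have [a [c [a0 lac]]] := sP x.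
set y := _ - _ in lac.
have [a' [b [a'0 a'b]]] := oreA (t y) tp.
exists (a' * a), (fun j => if j is j'.+1 then a' * c j' else b); split.
  by apply/negP => /eqP/domainA; rewrite (negPf a0) (negPf a'0).
move=> i; rewrite big_ord_recl /=.
have -> : (a' * a) *: x - (b *: p + \sum_(j < size s) (a' * c j) *: s`_j) =
          a' *: y - b *: p.
  rewrite scalerBr scalerA scaler_sumr opprD addrA addrAC; congr (_ - _ - _).
  by apply: eq_bigr => j _; rewrite scalerA.
rewrite linearB !linearZ /=; case: (unliftP ord_max i) => [j|] ->.
  by rewrite lac lp oppr0 !scaler0 addr0.
by rewrite scalerN [a' *: _]a'b subrr.
Qed.

(** Finite rank comes from the embedding in P, hence in a finite free module.
    The coordinates of x in a free module containing T are detected by any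
    nonzero multiple of x, as [A] has no zero divisors, so all of T has its
    coordinates in the finite joint support D of the vectors s. *)
Lemma projective_finite_rank (T P : lmodType A) (j : {linear T -> P}) :
  projective T -> projective P -> finitely_generated P -> injective j ->
  finitely_generated T.
Proof.
move=> projT projP [gens gensP] j_inj.
pose phi (i : 'I_(size gens)) := gens`_i.
have [x|tau tauK] := dual_basis (phi := phi) projP.
  have [c ->] := gensP x.
  exists (\sum_(i < size gens) mkmalgU i (c i)).
  rewrite linear_sum; apply: eq_bigr => i _.
  rewrite /= (combinationw _ msuppU_le) big_seq_fset1.
  by rewrite mcoeffUU.
have [s sP] := finite_rank (fun i => coordinate i \o (tau \o j)).
have {}sP x : exists (a : A) (c : nat -> A),
    a != 0 /\ a *: x = \sum_(j < size s) c j *: s`_j.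
  have [a [c [a0 lac]]] := sP x; exists a, c; split=> //.
  apply: subr0_eq; apply: j_inj; rewrite linear0.
  apply: (can_inj tauK); rewrite linear0; apply/malgP => i.
  by rewrite mcoeff0; exact: lac.
have [x|sigma sigmaK] := dual_basis (phi := @id T) projT.
  exists (mkmalgU x 1).
  by rewrite /= (combinationw _ msuppU_le) big_seq_fset1 mcoeffUU scale1r.
pose D := \big[fsetU/fset0]_(y <- s) msupp (sigma y).
have suppD x : fsubset (msupp (sigma x)) D.
  have [a [c [a0 axE]]] := sP x.
  apply/fsubsetP => k; rewrite -mcoeff_neq0; apply: contraNT => kD.
  have : a * mcoeff k (sigma x) = 0.
    rewrite -mcoeffZ -linearZ /= axE linear_sum /= raddf_sum big1 // => i _.
    rewrite linearZ /= mcoeffZ mcoeff_outdom ?mulr0 //.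
    apply: contraNN kD => kD; apply/bigfcupP.
    by exists s`_i => //; rewrite mem_nth.
  by move/domainA; rewrite (negPf a0).
(* The basis of the free module is T itself, so D is at once a set of
   coordinates and a set of generators. *)
exists (enum_fset D) => x.
exists (fun i => mcoeff (nth 0 (enum_fset D) i) (sigma x)).
rewrite -{1}[x]sigmaK (combinationw _ (suppD x)).
by rewrite (big_nth 0) big_mkord.
Qed.

End FiniteRank.

Lemma finitely_generated0 (A : nzRingType) (M : lmodType A) :
  (forall x : M, x = 0) -> finitely_generated M.
Proof.
move=> M0; exists [::] => x; exists (fun=> 0).
by rewrite big_ord0; exact: M0.
Qed.

(** * Finiteness properties over an Ore group ring *)

Section Finiteness.
Variable G : groupType.
Local Notation ZG := (group_ring G).

(** In dimension m + 1 the truncated resolution consists of retracts of finitely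
    generated modules up to degree m, and its top term embeds in degree m.
    In dimension 0 the resolution of length 0 is already of finite type, being
    concentrated in degree 0 where it is isomorphic to the trivial module. *)
Lemma type_FP_of_Ore (n : nat) :
  GRing.integral_domain_axiom ZG -> left_Ore ZG ->
  cd_le G n -> type_FPn G (n%:Z - 1) -> type_FP G.
Proof.
move=> domainZG oreZG [Q Qn] [P Pfg].
case: n => [|m] in Qn Pfg *.
  exists Q; split; first by exists 0%N.
  case=> [|k]; last by apply: finitely_generated0; apply: Qn.
  have [q augq] := @res_aug_surj _ _ Q (1 : int).
  pose c x : ZG := mkmalgU 1%g (res_aug Q x : int).
  exists [:: q] => x; exists (fun=> c x).
  rewrite big_ord1 /=; apply: subr0_eq.
  have /res_exact0[y <-] : res_aug Q (x - c x *: q) = 0.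
    rewrite linearB linearZ /= augq.
    have -> : c x *: (1 : trivial_module G) = gr_aug (c x) * 1 by [].
    by rewrite gr_augU mulr1; exact: subrr.
  by rewrite (Qn 1%N isT y) linear0.
have Q_inj z : res_diff Q m z = 0 -> z = 0.
  by move/res_exactS => [y <-]; rewrite (Qn m.+2 (ltnSn _) y) linear0.
have [e [de e0]] := resolution_split P Q_inj.
have [T [Tlen TP]] := resolution_truncation de e0.
have Pfg_le k : (k <= m)%N -> finitely_generated (P k).
  by move=> km; apply: Pfg; rewrite -addn1 PoszD addrK lez_nat.
exists T; split; first by exists m.+1.
move=> k; have [km|mk|->] := ltngtP k m.+1.
- have [s [r sK]] := TP k.
  apply: (finitely_generated_quotient (r := r)) (Pfg_le _ km) => y.
  by exists (s y).
- by apply: finitely_generated0; apply: Tlen.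
have [s [r sK]] := TP m.
apply: (projective_finite_rank domainZG oreZG (j := s \o res_diff T m)
  (@res_projective _ _ T _) (@res_projective _ _ P _) (Pfg_le _ (leqnn m))).
apply: inj_comp (can_inj sK) _ => x y dxy; apply: subr0_eq.
have /res_exactS[z <-] : res_diff T m (x - y) = 0 by rewrite linearB dxy subrr.
by rewrite (Tlen m.+2 (ltnSn _) z) linear0.
Qed.
End Finiteness.

(** * Transversals of the supports of independent vectors *)

(** The matrix of the coordinates of the [v i] has linearly independent rows
    over the rationals, after clearing denominators, so some maximal minor is
    nonzero; a nonzero term of its Leibniz expansion is a transversal. *)
Lemma independent_transversal (I : finType) (K : choiceType)
    (v : I -> malg K int) :
  (forall c : I -> int, \sum_i v i *~ c i = 0 -> forall i, c i = 0) ->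
  exists sigma : I -> K,
    injective sigma /\ forall i, mcoeff (sigma i) (v i) != 0.
Proof.
move=> v_free; pose D := \big[fsetU/fset0]_i msupp (v i).
pose w (j : 'I_#|{: D}|) : K := fsval (enum_val j).
pose M : 'M[rat]_(#|I|, #|{: D}|) :=
  \matrix_(r, j) (mcoeff (w j) (v (enum_val r)))%:~R.
have M_free : row_free M.
  apply: inj_row_free => u uM.
  (* A common denominator of the coefficients of a rational relation. *)
  pose d := \prod_r denq (u 0 r).
  have d_neq0 : d != 0 by apply/prodf_neq0 => r _; exact: denq_neq0.
  pose z r := numq (u 0 r) * \prod_(r' | r' != r) denq (u 0 r').
  have zE r : (z r)%:~R = u 0 r * d%:~R.
    by rewrite /z /d [in RHS](bigD1 r) //= !intrM numqE mulrA.
  have z0 : forall i, z (enum_rank i) = 0.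
    apply: v_free; apply/malgP => k; rewrite mcoeff0 raddf_sum /=.
    have [kD|kD] := boolP (k \in D); last first.
      rewrite big1 // => i _; rewrite raddfMz /= mcoeff_outdom ?mul0rz //.
      apply: contraNN kD => ki; apply/bigfcupP.
      by exists i; rewrite ?mem_index_enum.
    pose j := enum_rank (FSetSub kD : {: D}).
    apply: (@intr_inj rat); rewrite rmorph0 rmorph_sum /=.
    transitivity (d%:~R * (u *m M) 0 j); last by rewrite uM mxE mulr0.
    rewrite mxE mulr_sumr (reindex (@enum_rank I)) /=; last first.
      by apply: onW_bij; exact: enum_rank_bij.
    apply: eq_bigr => i _; rewrite raddfMz /=.
    have -> : mcoeff k (v i) *~ z (enum_rank i) =
        mcoeff k (v i) * z (enum_rank i) by rewrite -mulrzr intz.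
    rewrite intrM zE mxE enum_rankK /w /j enum_rankK /=.
    by rewrite [LHS]mulrC [u 0 _ * d%:~R]mulrC -mulrA.
  apply/rowP => r; rewrite mxE; have := zE r.
  rewrite -[r]enum_valK z0 => /esym/eqP.
  by rewrite mulf_eq0 intr_eq0 (negPf d_neq0) orbF => /eqP.
have Mt_full : row_full M^T by rewrite /row_full mxrank_tr.
have := fullrowsub_unit Mt_full; set f := fullrankfun Mt_full.
rewrite unitmxE unitfE => det_neq0.
have /existsP[s /forallP sP] :
    [exists s : {perm 'I_#|I|}, [forall r, M (s r) (f r) != 0]].
  apply: contraNT det_neq0 => /existsPn noS.
  rewrite /determinant big1 // => s _.
  have /forallPn[r /negPn/eqP Mr0] := noS s.
  by rewrite (bigD1 r) //= 2!mxE Mr0 mul0r mulr0.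
pose sigma i := w (f ((s^-1)%g (enum_rank i))).
exists sigma; split=> [i j|i].
  move/val_inj/enum_val_inj/fullrankfun_inj/perm_inj.
  exact: enum_rank_inj.
have := sP ((s^-1)%g (enum_rank i)).
by rewrite permKV mxE enum_rankK intr_eq0.
Qed.

(** * Amenable groups admit no doubling of bounded displacement *)

Section SubtypeTopology.
Local Open Scope classical_set_scope.

Lemma compact_set_type (X : topologicalType) (A : set X) :
  compact A -> compact [set: set_type A].
Proof.
move=> cptA F FF _.
have [|x [Ax clFx]] := cptA (set_val @ F) _.
  by apply: (@filterE _ F) => y; exact: set_valP.
exists (exist _ x (mem_set Ax)); split=> // B U FB.
move=> [_ [[V oV <-] Vx] VU].
have FB' : (set_val @ F) (set_val @` B).
  by apply: (@filterS _ F) FB => y By; exists y.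
have [_ [[y By <-] Vy]] := clFx _ _ FB' (open_nbhs_nbhs (conj oV Vx)).
by exists y; split=> //; exact: VU.
Qed.

Lemma hausdorff_set_type (X : topologicalType) (A : set X) :
  hausdorff_space X -> hausdorff_space (set_type A).
Proof.
move=> hX x y clxy; apply: val_inj; apply: hX => U V xU yV.
have cont := @initial_continuous (set_type A) X set_val.
have [z [Uz Vz]] := clxy _ _ (cont x U xU) (cont y V yV).
by exists (set_val z).
Qed.

End SubtypeTopology.

Section Doubling.
Local Open Scope classical_set_scope.
Variables (G : groupType) (S : bool -> {fset G}).

Definition point_map : Type := {ptws (G * bool)%type -> discrete_topology G}.
HB.instance Definition _ := Topological.on point_map.

Lemma eval_nbhs (F : point_map) p : nbhs F [set F' : point_map | F' p = F p].
Proof.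
have /(_ [set F p]) := @proj_continuous _ (fun=> discrete_topology G) p F.
by apply; exact: discrete_set1.
Qed.

Lemma point_map_continuous (X : topologicalType) (f : X -> point_map) :
  (forall x p, nbhs x [set y | f y p = f x p]) -> continuous f.
Proof.
move=> fP x; apply/cvg_sup => p.
move=> U [_ [[V oV <-] Vx] VU]; apply: filterS (fP x p) => y fy.
by apply: VU; rewrite /= fy.
Qed.

Lemma hausdorff_point_map : hausdorff_space point_map.
Proof.
by apply: (@hausdorff_product _ (fun=> discrete_topology G)) => p;
  exact: discrete_hausdorff.
Qed.

Definition bounded_displacement : set point_map :=
  [set F | forall p, (p.1^-1 * F p)%g \in S p.2].

Lemma compact_bounded_displacement : compact bounded_displacement.
Proof.
pose A (p : G * bool) : set (discrete_topology G) :=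
  [set h | (p.1^-1 * h)%g \in S p.2].
apply: (@tychonoff _ (fun=> discrete_topology G) A) => p.
apply: finite_compact.
apply: (@sub_finite_set _ _ [set` [fset (p.1 * s)%g | s in S p.2]%fset]);
  last exact: finite_fset.
move=> h hS; apply/imfsetP; exists (p.1^-1 * h)%g => //=.
by rewrite mulKVg.
Qed.

(** Two injections of G into itself with disjoint images, indexed by [bool],
    the one at b moving each g into the finite set g (S b). *)
Definition doublings : set point_map :=
  [set F | bounded_displacement F /\ injective F].

Lemma compact_doublings : compact doublings.
Proof.
apply: subclosed_compact compact_bounded_displacement _; last by move=> F [].
move=> F clF; split=> [p|p q Fpq].
  have [F' [[F'S _]] /= <-] := clF _ (eval_nbhs F p); exact: F'S.
have [F' [[_ F'inj] [/= F'p F'q]]] :=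
  clF _ (filterI (eval_nbhs F p) (eval_nbhs F q)).
by apply: F'inj; rewrite F'p F'q.
Qed.

(** The compactness step of the infinite marriage theorem.  The filter
    generated by the maps injective over finite sets D has a cluster point, and
    F p = F q can be tested on a D that contains the two arguments. *)
Lemma doublings_neq0 :
  (forall D : {fset G}, exists F, bounded_displacement F /\ forall p q,
     p.1 \in D -> q.1 \in D -> F p = F q -> p = q) ->
  doublings !=set0.
Proof.
move=> finP.
pose C (D : {fset G}) : set point_map :=
  [set F | bounded_displacement F /\ forall p q,
     p.1 \in D -> q.1 \in D -> F p = F q -> p = q].
have FF : ProperFilter (filter_from setT C).
  apply: filter_from_proper => [|D _]; last exact: finP.
  apply: filter_from_filter => [|D D' _ _]; first by exists fset0.
  exists (D `|` D')%fset => // F [FS FD]; split; split=> // p q pD qD;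
    by apply: FD; rewrite in_fsetU ?pD ?qD ?orbT.
have [|F [FS clF]] := compact_bounded_displacement (F := filter_from setT C) _.
  by exists fset0 => // F [].
exists F; split=> // p q Fpq.
have [F' [[_ F'inj] [/= F'p F'q]]] := clF (C [fset p.1; q.1]%fset) _
  (ex_intro2 _ _ _ I (fun _ => id))
  (filterI (eval_nbhs F p) (eval_nbhs F q)).
by apply: F'inj; rewrite ?F'p ?F'q // in_fset2 eqxx ?orbT.
Qed.

(** Translation of both the argument and the value only permutes the
    displacements g^-1 F(g, b), so it preserves [doublings]. *)
Definition shift (h : G) (F : point_map) : point_map :=
  fun p => (h * F (h^-1 * p.1, p.2))%g.

Lemma shift_doublings h F : doublings F -> doublings (shift h F).
Proof.
move=> [FS Finj]; split=> [p|p q /mulgI/Finj].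
  by have := FS (h^-1 * p.1, p.2)%g; rewrite /= invMg invgK mulgA.
by case: p q => [g b] [g' b'] [/mulgI -> ->].
Qed.

Section Space.
Variables (F0 : point_map) (F0P : doublings F0).

(** The base point F0 is a parameter of the type, so that its pointed structure
    can be declared; the underlying space is that of all doublings. *)
Definition doubling_space : Type := let _ := F0P in set_type doublings.
HB.instance Definition _ := Topological.on doubling_space.
HB.instance Definition _ :=
  isPointed.Build doubling_space (exist _ F0 (mem_set F0P)).

Definition doubling_act (h : G) (F : doubling_space) : doubling_space :=
  exist _ (shift h (set_val F)) (mem_set (shift_doublings h (set_valP F))).

Lemma doubling_act_continuous :
  continuous (fun p : discrete_topology G * doubling_space =>
    doubling_act p.1 p.2).
Proof.
apply: (@continuous_comp_initial _ _ point_map set_val).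
apply: point_map_continuous => -[h F] p /=.
pose q : G * bool := (h^-1 * p.1, p.2)%g.
exists ([set h], [set F' : doubling_space | set_val F' q = set_val F q]).
  split; first exact: (@discrete_set1 (discrete_topology G)).
  exact: (@initial_continuous (set_type doublings) point_map set_val F _
    (eval_nbhs (set_val F) q)).
by move=> [h' F'] /= [-> F'q]; rewrite set_valE /= /shift -/q F'q.
Qed.

Lemma measurable_eval (p : G * bool) (h : G) :
  measurable ([set F | set_val F p = h] : set (Borel doubling_space)).
Proof.
apply: sub_sigma_algebra.
rewrite openE => F /= <-.
exact: (@initial_continuous (set_type doublings) point_map set_val F _
  (eval_nbhs (set_val F) p)).
Qed.
End Space.

(** Mass transport.  For an invariant law, F(1, b) = s and F(s^-1, b) = 1 are
    equally likely.  Summing over s in S b, the identity almost surely lies in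
    the image of G x {b}; but the images for the two values of b are
    disjoint. *)
Lemma amenable_no_doublings (R : realType) :
  amenable R G -> doublings = set0.
Proof.
move=> amG; apply/eqP/negPn/negP => /set0P[F0 F0P].
pose X := doubling_space F0P.
have [||F|g h F||P Pinv] := amG X (@doubling_act F0 F0P).
- exact: compact_set_type compact_doublings.
- exact: hausdorff_set_type hausdorff_point_map.
- apply: val_inj; apply/funext => -[g b].
  by rewrite /= /shift /= invg1 !mul1g.
- apply: val_inj; apply/funext => -[k b].
  by rewrite /= /shift /= invMg !mulgA.
- exact: doubling_act_continuous.
pose at1 b s : set (Borel X) := [set F | set_val F (1%g, b) = s].
pose hit1 b s : set (Borel X) := [set F | set_val F (s^-1%g, b) = 1%g].
have at1_hit1 b s : P (at1 b s) = P (hit1 b s).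
  rewrite -[RHS](Pinv s^-1%g); last exact: measurable_eval.
  congr (P _); apply/seteqP; split=> F; rewrite /at1 /hit1 /=.
    by move=> F1; rewrite set_valE /= /shift /= mulVg F1 mulVg.
  rewrite {1}set_valE /= /shift /= mulVg => /(congr1 (mulg s)).
  by rewrite mulKVg mulg1.
pose hit b := \big[setU/set0]_(s <- S b) hit1 b s.
have hitP b F : hit b F -> exists g, set_val F (g, b) = 1%g.
  by rewrite /hit -bigcup_seq => -[s _ Fs]; exists s^-1%g.
have measurable_hit b : measurable (hit b).
  by apply: bigsetU_measurable => s _; exact: measurable_eval.
have P_hit b : P (hit b) = 1%E.
  rewrite measure_fbigsetU; last first.
  - move=> s t _ _ [F [/= Fs Ft]]; apply: invg_inj.
    by have [_ Finj] := set_valP F; have /Finj[] := etrans Fs (esym Ft).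
  - by move=> s _; exact: measurable_eval.
  rewrite (eq_bigr _ (fun s _ => esym (at1_hit1 b s))).
  rewrite -measure_fbigsetU; last first.
  - by move=> s t _ _ [F [/= <- <-]].
  - by move=> s _; exact: measurable_eval.
  rewrite -(@probability_setT _ _ _ P); congr (P _).
  apply/seteqP; split=> // F _; rewrite -bigcup_seq.
  exists (set_val F (1%g, b)) => //=.
  by have [/(_ (1%g, b)) + _] := set_valP F; rewrite /= invg1 mul1g.
have P_union : P (hit true `|` hit false) = (P (hit true) + P (hit false))%E.
  apply: measureU => //; apply/seteqP; split=> // F [/hitP[g Fg] /hitP[h Fh]].
  by have [_ Finj] := set_valP F; have /Finj[] := etrans Fg (esym Fh).
have := @probability_le1 _ _ _ P (hit true `|` hit false)
  (measurableU _ _ (measurable_hit _) (measurable_hit _)).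
by rewrite P_union !P_hit -EFinD lee_fin -[leRHS]addr0 lerD2l ler10.
Qed.
End Doubling.

(** * The Ore condition for group rings of amenable groups *)

Section Ore.
Variables (R : realType) (G : groupType).
Local Notation ZG := (group_ring G).

Definition group_element (g : G) : ZG := mkmalgU g 1.

Lemma mcoeff_translate (g k : G) (a : ZG) :
  mcoeff k (group_element g * a) = mcoeff (g^-1 * k)%g a.
Proof.
have -> : group_element g * a = gr_mul (mkmalgU g 1) a by [].
rewrite (gr_mulw msuppU_le (fsubset_refl _)) big_seq_fset1 raddf_sum /=.
rewrite [in RHS](gr_expand a) [RHS]raddf_sum /=.
apply: eq_bigr => h _; rewrite /= mcoeffUU mul1r !mcoeffU.
by rewrite eq_sym -(inj_eq (mulgI g^-1%g)) mulKg eq_sym.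
Qed.

(** A relation between the translates of a and b is an equation x a + y b = 0
    in the group ring, whose solution x, y collects the coefficients. *)
Lemma independent_translates (a b : ZG) (D : {fset G}) (c : D * bool -> int) :
  GRing.integral_domain_axiom ZG -> b != 0 ->
  (forall x y : ZG, x * a = y * b -> x = 0) ->
  \sum_p (group_element (val p.1) * (if p.2 then a else b)) *~ c p = 0 ->
  forall p, c p = 0.
Proof.
move=> domainZG b0 ab.
pose x t : ZG := \sum_(g : D) mkmalgU (val g) (c (g, t)).
have xE t : x t = \sum_(g : D) group_element (val g) *~ c (g, t).
  by apply: eq_bigr => g _; rewrite -raddfMz /= intz.
have -> : \sum_p (group_element (val p.1) * (if p.2 then a else b)) *~ c p =
    \sum_(g : D) \sum_t
      (group_element (val g) * (if t then a else b)) *~ c (g, t).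
  by rewrite pair_bigA; apply: eq_bigr => -[g t].
under eq_bigr do rewrite big_bool /= -!mulrzAl.
rewrite big_split -!mulr_suml /= -!xE => xab.
have x0 : x true = 0.
  by apply: (ab _ (- x false)); rewrite mulNr; apply/eqP; rewrite -addr_eq0 xab.
have y0 : x false = 0.
  move: xab; rewrite x0 mul0r add0r => /domainZG.
  by rewrite (negPf b0) orbF => /eqP.
have x00 t : x t = 0 by case: t.
move=> [g t]; have := congr1 (mcoeff (val g)) (x00 t).
rewrite mcoeff0 raddf_sum (bigD1 g) //= mcoeffUU big1 ?addr0 // => h hg.
by rewrite mcoeffU (inj_eq val_inj) (negPf hg).
Qed.

(** Without a common left multiple, the supports of the translates of a and b
    have transversals over every finite part of G, and these amount to partial
    doublings with S the pair of supports of a and b. *)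
Lemma amenable_left_Ore :
  amenable R G -> GRing.integral_domain_axiom ZG -> left_Ore ZG.
Proof.
move=> amG domainZG a b b0.
have [->|a0] := eqVneq a 0.
  by exists 1, 0; rewrite oner_neq0 mulr0 mul0r.
apply: contrapT => noOre.
have ab (x y : ZG) : x * a = y * b -> x = 0.
  move=> xy; apply/eqP; apply: contrapT => /negP x0.
  by apply: noOre; exists x, y.
pose S (t : bool) : {fset G} := msupp (if t then a else b).
have S_neq0 t : exists s, s \in S t.
  have nz : (if t then a else b) != 0 by case: t.
  apply/fset0Pn; apply: contraNneq nz => S0; apply/eqP.
  by rewrite (gr_expand (if t then a else b)) -/(S t) S0 big_seq_fset0.
have := @amenable_no_doublings G S R amG; apply/eqP/set0P.
apply: doublings_neq0 => D.
have [sigma [sigma_inj sigmaP]] := independent_transversal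
  (fun c => @independent_translates a b D c domainZG b0 ab).
have [s sS] := choice S_neq0.
(* Outside D the value only has to respect the displacement bound. *)
exists (fun p : G * bool =>
  if insub p.1 is Some g then sigma (g, p.2) else (p.1 * s p.2)%g).
split=> [[g t]|[g t] [g' t']] /=.
  case: insubP => [u _ <-|_]; last by rewrite mulKg.
  by have := sigmaP (u, t); rewrite mcoeff_translate mcoeff_neq0.
move=> gD g'D; rewrite (insubT (fun g => g \in D) gD).
by rewrite (insubT (fun g => g \in D) g'D); move=> /sigma_inj [-> ->].
Qed.
End Ore.

Theorem theoremA (R : realType) (G : groupType) (n : nat)
    (amenableG : amenable R G)
    (domainZG : GRing.integral_domain_axiom (group_ring G))
    (cdG : has_cd G n)
    (FPG : type_FPn G (n%:Z - 1)) :
  type_FP G.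
Proof.
have [cd_le_n _] := cdG.
have oreZG := amenable_left_Ore amenableG domainZG.
exact: type_FP_of_Ore domainZG oreZG cd_le_n FPG.
Qed.
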